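(* Let $A$ be a sub-Hilbert algebra, and let $D$ be the complete sublattice of $\mathrm{IFil}(A)^+$ generated by $j(\square A)$. Then the pair $(\mathrm{IFil}(A)^+,D)$ is a subresiduated lattice in which $j(A)$ is (the universe of) a subalgebra of the implicative reduct that is isomorphic to $A$.
   Context: A sub-Hilbert algebra is an algebra $(A,\to,1)$ of type $(2,0)$ satisfying, for all $x,y,z\in A$: (B) $(x\to y)\to((y\to z)\to(x\to z))=1$; (I) $x\to x=1$; (T) $x\to 1=1$; (A) if $x\to y=1$ and $y\to x=1$ then $x=y$; (S) $(x\to(y\to z))\to((x\to y)\to(x\to z))=1$. Put $\square a:=1\to a$ and $\square A:=\{\square a: a\in A\}$. An implicative filter of $A$ is a subset $F\subseteq A$ such that $1\in F$, and for all $a,b\in A$, if $a\in F$ and $a\to b\in F$ then $b\in F$. $\mathrm{IFil}(A)$ is the set of implicative filters of $A$, ordered by inclusion. For a poset $X$, $X^+$ is the complete lattice of upsets of $X$ (ordered by inclusion, with unions and intersections as joins and meets). The map $j:A\to\mathrm{IFil}(A)^+$ is $j(a):=\{F\in\mathrm{IFil}(A): a\in F\}$. Complete sublattices are closed under arbitrary (including empty) joins and meets. A pair $(L,D)$ is a subresiduated lattice if $L$ is a bounded distributive lattice, $D$ is a bounded sublattice of $L$ (with the same $0$ and $1$), and for all $a,b\in L$ the set $\{d\in D: d\wedge a\le b\}$ has a maximum; its implication is $a\Rightarrow b:=\max\{d\in D: d\wedge a\le b\}$. The implicative reduct of $(L,D)$ is $(L,\Rightarrow,1)$. *)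

(* Defs.v *)
From HB Require Import structures.
From mathcomp Require Import all_boot all_order.
From mathcomp Require Import boolp classical_sets.

Set Implicit Arguments.
Unset Strict Implicit.
Unset Printing Implicit Defensive.

Import Order.TTheory.
Local Open Scope classical_set_scope.

(* The suffix 20 is the similarity type (2,0). *)
Record alg20 : Type := Alg20 {
  carrier :> Type;
  imp : carrier -> carrier -> carrier;
  one : carrier }.

Arguments one {_}.

Declare Scope alg20_scope.
Delimit Scope alg20_scope with A.
Notation "x ~> y" := (imp x y)
  (at level 55, right associativity) : alg20_scope.
Notation "1" := one : alg20_scope.
Local Open Scope alg20_scope.

Record sub_hilbert (A : alg20) : Prop := SubHilbert {
  sub_hilbertB : forall x y z : A, (x ~> y) ~> ((y ~> z) ~> (x ~> z)) = 1;
  sub_hilbertI : forall x : A, x ~> x = 1;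
  sub_hilbertT : forall x : A, x ~> 1 = 1;
  sub_hilbertA : forall x y : A, x ~> y = 1 -> y ~> x = 1 -> x = y;
  sub_hilbertS : forall x y z : A,
    (x ~> (y ~> z)) ~> ((x ~> y) ~> (x ~> z)) = 1 }.

Definition box (A : alg20) (a : A) : A := 1 ~> a.

Definition subuniverse (A : alg20) (S : set A) : Prop :=
  S 1 /\ forall x y : A, S x -> S y -> S (x ~> y).

Definition subalgebra (A : alg20) (S : set A) (hS : subuniverse S) : alg20 :=
  @Alg20 {x : A | S x}
    (fun u v => exist S (sval u ~> sval v)
                      (hS.2 (sval u) (sval v) (svalP u) (svalP v)))
    (exist S 1 hS.1).

Definition isomorphic (A B : alg20) : Prop :=
  exists f : A -> B,
    [/\ bijective f, f 1 = 1 & forall x y : A, f (x ~> y) = f x ~> f y].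

Section ImplicativeFilters.
Variable A : alg20.

Definition implicative_filter (F : set A) : Prop :=
  F 1 /\ forall a b : A, F a -> F (a ~> b) -> F b.

Record ifil : Type := Ifil {
  ifil_set :> set A;
  _ : `[< implicative_filter ifil_set >] }.

HB.instance Definition _ := [isSub for ifil_set].
HB.instance Definition _ := [Choice of ifil by <:].
HB.instance Definition _ :=
  [SubChoice_isSubPOrder of ifil by <: with set_display].

Lemma ifilP (F : ifil) : implicative_filter F.
Proof. by case: F => F /= /asboolP. Qed.

Lemma le_ifilE (F G : ifil) :
  (F <= G)%O = ((F : set A) `<=` (G : set A)) :> Prop.
Proof. by rewrite -Order.le_val /= subsetEset. Qed.

End ImplicativeFilters.

Section Upsets.
Context {d : Order.disp_t} (X : porderType d).

Definition is_upset : {pred set X} :=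
  fun U => `[< forall x y : X, (x <= y)%O -> U x -> U y >].

Fact is_upset_meet : Order.ClosedPredicates.meet_closed is_upset.
Proof.
move=> U V /asboolP hU /asboolP hV; apply/asboolP => x y xy [Ux Vx].
by split; [exact: hU Ux|exact: hV Vx].
Qed.

Fact is_upset_join : Order.ClosedPredicates.join_closed is_upset.
Proof.
move=> U V /asboolP hU /asboolP hV; apply/asboolP => x y xy.
by case=> [Ux|Vx]; [left; exact: hU Ux|right; exact: hV Vx].
Qed.

Fact is_upset_bot : \bot%O \in is_upset.
Proof. by apply/asboolP. Qed.

Fact is_upset_top : \top%O \in is_upset.
Proof. by apply/asboolP. Qed.

HB.instance Definition _ :=
  Order.isLatticeClosed.Build _ (set X) is_upset is_upset_meet is_upset_join.
HB.instance Definition _ :=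
  Order.isBLatticeClosed.Build _ (set X) is_upset is_upset_bot.
HB.instance Definition _ :=
  Order.isTLatticeClosed.Build _ (set X) is_upset is_upset_top.

Record upset : Type := Upset {
  upset_set :> set X;
  _ : upset_set \in is_upset }.

HB.instance Definition _ := [isSub for upset_set].
HB.instance Definition _ := [Choice of upset by <:].
HB.instance Definition _ :=
  [SubChoice_isTBSubLattice of upset by <: with set_display].

Lemma upset_meetE (U V : upset) : (U `&` V)%O = (U : set X) `&` V :> set X.
Proof. by []. Qed.

Lemma upset_joinE (U V : upset) : (U `|` V)%O = (U : set X) `|` V :> set X.
Proof. by []. Qed.

Fact upset_meetUl : left_distributive (@Order.meet _ upset) Order.join.
Proof.
move=> U V W; apply: val_inj.
exact: setIUl.
Qed.

HB.instance Definition _ :=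
  Order.Lattice_Meet_isDistrLattice.Build set_display upset upset_meetUl.

Lemma upsetP (U : upset) (x y : X) : (x <= y)%O -> (U : set X) x -> (U : set X) y.
Proof. by case: U => U /= /asboolP hU xy; exact: hU xy. Qed.

Lemma le_upsetE (U V : upset) :
  (U <= V)%O = ((U : set X) `<=` (V : set X)) :> Prop.
Proof. by rewrite -Order.le_val /= subsetEset. Qed.

Lemma upset_botE : (\bot%O : upset) = set0 :> set X.
Proof. by []. Qed.

Lemma upset_topE : (\top%O : upset) = setT :> set X.
Proof. by []. Qed.

Fact is_upset_bigcup (S : set upset) :
  (\bigcup_(U in S) (U : set X)) \in is_upset.
Proof.
by apply/asboolP => x y xy [U SU Ux]; exists U => //; exact: upsetP Ux.
Qed.

Fact is_upset_bigcap (S : set upset) :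
  (\bigcap_(U in S) (U : set X)) \in is_upset.
Proof.
by apply/asboolP => x y xy hx U SU; exact: upsetP (hx U SU).
Qed.

Definition upset_bigcup (S : set upset) : upset := Upset (is_upset_bigcup S).
Definition upset_bigcap (S : set upset) : upset := Upset (is_upset_bigcap S).

Lemma upset_bigcup_sup (S : set upset) : supremums S (upset_bigcup S).
Proof.
split=> [U SU|V hV]; rewrite le_upsetE; first by move=> x Ux; exists U.
by move=> x [U SU Ux]; have := hV U SU; rewrite le_upsetE; apply.
Qed.

Lemma upset_bigcap_inf (S : set upset) : infimums S (upset_bigcap S).
Proof.
split=> [U SU|V hV]; rewrite le_upsetE; first by move=> x; apply.
by move=> x Vx U SU; have := hV U SU; rewrite le_upsetE; apply.
Qed.

(* The case S = set0 forces \bot and \top into C. *)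
Definition complete_sublattice (C : set upset) : Prop :=
  forall S : set upset, S `<=` C -> C (upset_bigcup S) /\ C (upset_bigcap S).

End Upsets.

Fact jmap_subproof (A : alg20) (a : A) :
  [set F : ifil A | (F : set A) a] \in @is_upset _ (ifil A).
Proof. by apply/asboolP => F G; rewrite le_ifilE; apply. Qed.

Definition jmap (A : alg20) (a : A) : upset (ifil A) :=
  Upset (jmap_subproof a).

Section Subresiduated.
Context {d : Order.disp_t} (L : tbDistrLatticeType d).
Implicit Types (D : set L) (a b m : L).

Definition is_maximum (S : set L) m : Prop := S m /\ ubound S m.

Definition bounded_sublattice D : Prop :=
  [/\ D \bot%O, D \top%O,
      forall a b, D a -> D b -> D (a `&` b)%O
    & forall a b, D a -> D b -> D (a `|` b)%O].

Definition res_set D a b : set L := [set c | D c /\ (c `&` a <= b)%O].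

Definition subresiduated D : Prop :=
  bounded_sublattice D /\ forall a b, exists m, is_maximum (res_set D a b) m.

(* \bot is a junk value, taken only when the maximum does not exist. *)
Definition subres_imp D a b : L := xget \bot%O (is_maximum (res_set D a b)).

Lemma subres_impP D a b :
  subresiduated D -> is_maximum (res_set D a b) (subres_imp D a b).
Proof. by case=> _ /(_ a b) [m hm]; exact: xgetI hm. Qed.

Definition implicative_reduct D : alg20 := Alg20 (subres_imp D) \top%O.

End Subresiduated.

(* Main.v *)
Require Import Defs.
From mathcomp Require Import all_boot all_order.
From mathcomp Require Import boolp classical_sets.

(** The crux is j(a) => j(b) = j(a ~> b). Membership of a filter F in an element
    of D depends monotonically only on the boxed elements of F. If F lies in
    d \in D with d /\ j(a) <= j(b), then G := {x | a ~> x \in F} is an implicative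
    filter that contains a and every boxed element of F, so G lies in d, hence in
    j(b), which says that a ~> b \in F. Conversely j(a ~> b) belongs to D because
    box (a ~> b) = a ~> b. *)

Local Open Scope classical_set_scope.
Local Open Scope alg20_scope.

Section SubHilbertTheory.
Context {A : alg20} (hA : sub_hilbert A).
Implicit Types (a b c x y z : A) (F : set A).

(** Since (T) supplies [x ~> 1 = 1], antisymmetry applies. This strips the prefix [1 ~>] left when a
    premise of an axiom instance collapses to [1]. *)
Lemma box_eq1 {x} : 1 ~> x = 1 -> x = 1.
Proof. by move=> h; apply: (sub_hilbertA hA) => //; exact: sub_hilbertT. Qed.

Lemma box_le x : box x ~> x = 1.
Proof.
have := sub_hilbertS hA (box x) 1 x.
by rewrite (sub_hilbertI hA) (sub_hilbertT hA) => /box_eq1/box_eq1.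
Qed.

Lemma box_le_imp a b : box b ~> (a ~> b) = 1.
Proof.
by have := sub_hilbertB hA a 1 b; rewrite (sub_hilbertT hA) => /box_eq1.
Qed.

(** The inequality not covered by [box_le] is (B) at [a], [b], [b], whose middle term [b ~> b] is
    [1]. *)
Lemma box_imp a b : box (a ~> b) = a ~> b.
Proof.
apply: (sub_hilbertA hA); first exact: box_le.
by have := sub_hilbertB hA a b b; rewrite (sub_hilbertI hA).
Qed.

Lemma implicative_filter_le {F x y} :
  implicative_filter F -> x ~> y = 1 -> F x -> F y.
Proof. by move=> [F1 FM] xy Fx; apply: (FM x) => //; rewrite xy. Qed.

Lemma implicative_filter1 : implicative_filter [set (1 : A)].
Proof. by split=> // a b -> /box_eq1. Qed.

(** Axiom (S) is modus ponens under the common premise [a]. *)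
Lemma implicative_filter_imp {F} a :
  implicative_filter F -> implicative_filter [set x | F (a ~> x)].
Proof.
move=> hF; have [F1 FM] := hF.
split=> /= [|x y Fx Fxy]; first by rewrite (sub_hilbertT hA).
apply: (FM _ _ Fx).
exact: (implicative_filter_le hF (sub_hilbertS hA a x y) Fxy).
Qed.

Definition imp_filter (F : ifil A) a : ifil A :=
  Ifil (introT (asboolP _) (implicative_filter_imp a (ifilP F))).

Definition unit_filter : ifil A :=
  Ifil (introT (asboolP _) implicative_filter1).

(** The filter of all [x] with [a ~> x = 1] contains [a]; if [jmap a = jmap b], it also contains
    [b]. *)
Lemma jmap_inj : injective (@jmap A).
Proof.
suff jle a b : jmap a = jmap b -> a ~> b = 1.
  by move=> a b ab; apply: (sub_hilbertA hA); apply: jle.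
move=> ab; have : (jmap a : set _) (imp_filter unit_filter a).
  exact: sub_hilbertI.
by rewrite ab.
Qed.

Lemma jmap1 : jmap (1 : A) = \top%O.
Proof.
apply: val_inj; rewrite /= predeqE => F; split=> // _.
by have [] := ifilP F.
Qed.

Lemma imp_filter_box {F : ifil A} {a} c :
  (F : set A) (box c) -> (imp_filter F a : set A) (box c).
Proof.
apply: (implicative_filter_le (ifilP F)).
(* As [box] is idempotent, this instance reads [box c ~> (a ~> box c) = 1]. *)
by have := box_le_imp a (1 ~> c); rewrite box_imp.
Qed.

End SubHilbertTheory.

Section GeneratedSublattice.
Context {d : Order.disp_t} {X : porderType d}.
Implicit Types (C S : set (upset X)).

Lemma complete_sublattice_smallest S :
  complete_sublattice (smallest (@complete_sublattice _ X) S).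
Proof.
move=> T TD; split=> C [hC SC].
  by apply: (hC T _).1 => U /TD /(_ C); apply.
by apply: (hC T _).2 => U /TD /(_ C); apply.
Qed.

(** This serves as an induction principle: an implication between membership of [x] and of [y], once
    checked on generators, passes to the whole generated complete sublattice. *)
Lemma complete_sublattice_separation (x y : X) :
  complete_sublattice [set U : upset X | (U : set X) x -> (U : set X) y].
Proof.
move=> S SC; split=> /=.
  by move=> [U SU Ux]; exists U => //; exact: SC.
by move=> h U SU; exact/(SC U SU)/h.
Qed.

Lemma complete_sublattice_subresiduated {C} :
  complete_sublattice C -> subresiduated C.
Proof.
move=> hC; split.
  have set2_sub U V : C U -> C V -> [set U; V] `<=` C by move=> ? ? _ [->|->].
  split=> [||U V CU CV|U V CU CV].
  - suff <- : @upset_bigcup _ X set0 = \bot%O by apply: (hC _ _).1.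
    by apply: val_inj; exact: bigcup_set0.
  - suff <- : @upset_bigcap _ X set0 = \top%O by apply: (hC _ _).2.
    by apply: val_inj; exact: bigcap_set0.
  - suff <- : upset_bigcap [set U; V] = (U `&` V)%O.
      by apply: (hC _ _).2; exact: set2_sub.
    by apply: val_inj; rewrite /= bigcap_setU !bigcap_set1.
  - suff <- : upset_bigcup [set U; V] = (U `|` V)%O.
      by apply: (hC _ _).1; exact: set2_sub.
    by apply: val_inj; rewrite /= bigcup_setU !bigcup_set1.
(* The union of all candidates is again a candidate, because intersection with [U] distributes over
   arbitrary unions. *)
move=> U V; exists (upset_bigcup (res_set C U V)); split; last first.
  by move=> W hW; exact: (upset_bigcup_sup _).1.
split; first by apply: (hC _ _).1 => W [].
rewrite le_upsetE => x [[W [_]]].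
by rewrite le_upsetE => WUV Wx Ux; apply: WUV.
Qed.

End GeneratedSublattice.

(** Maxima are unique by antisymmetry, so exhibiting one computes the implication. *)
Lemma subres_imp_eq {d : Order.disp_t} {L : tbDistrLatticeType d} {D : set L}
    {a b m : L} :
  subresiduated D -> is_maximum (res_set D a b) m -> subres_imp D a b = m.
Proof.
move=> /(subres_impP a b) [h1 h2] [m1 m2].
by apply: Order.POrderTheory.le_anti; rewrite m2 //= h2.
Qed.

Theorem theorem3p23 (A : alg20) (hA : sub_hilbert A) :
  let D : set (upset (ifil A)) :=
    smallest (@complete_sublattice _ (ifil A))
             [set jmap b | b in [set box a | a in [set: A]]] in
  subresiduated D /\
  exists h : @subuniverse (implicative_reduct D) [set jmap a | a in [set: A]],
    isomorphic (subalgebra h) A.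
Proof.
move=> D.
have Dres : subresiduated D.
  exact/complete_sublattice_subresiduated/complete_sublattice_smallest.
have DboxP (U : upset (ifil A)) (F G : ifil A) : D U ->
    (forall c, (F : set A) (box c) -> (G : set A) (box c)) ->
    (U : set _) F -> (U : set _) G.
  move=> DU FG.
  apply: (DU _ (conj (complete_sublattice_separation F G) _)).
  by move=> _ [_ [c _ <-] <-]; exact: FG.
have jimp (a b : A) : subres_imp D (jmap a) (jmap b) = jmap (a ~> b).
  apply: subres_imp_eq => //; split; first split.
  - move=> C [_]; apply; exists (a ~> b) => //.
    by exists (a ~> b) => //; exact: box_imp.
  - rewrite le_upsetE => F [Fab Fa].
    exact: (ifilP F).2 Fa Fab.
  - move=> U [DU]; rewrite !le_upsetE => Uab F UF.
    apply: (Uab (imp_filter hA F a)); split.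
      exact: DboxP DU (imp_filter_box hA (F := F) (a := a)) UF.
    by rewrite /= (sub_hilbertI hA); case: (ifilP F).
split=> //.
have h : @subuniverse (implicative_reduct D) [set jmap a | a in [set: A]].
  split; first by exists 1 => //; exact: jmap1.
  move=> _ _ [a _ <-] [b _ <-]; exists (a ~> b) => //.
  by rewrite -jimp.
exists h.
(* [f] chooses a preimage under [jmap]; injectivity makes the choice unique, so [f] inverts [jmap]
   and inherits its compatibility with [~>] and [1]. *)
pose f (u : subalgebra h) : A := sval (cid2 (svalP u)).
have fK u : jmap (f u) = sval u by rewrite /f; case: cid2.
have fP u a : sval u = jmap a -> f u = a.
  by rewrite -fK => /(jmap_inj hA).
exists f; split.
- exists (fun a => exist _ (jmap a) (ex_intro2 _ _ a Logic.I erefl)) => [u|a].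
    by have := fK u; case: u => U SU /= fU; apply: eq_exist.
  exact: fP.
- by apply: fP; rewrite jmap1.
- by move=> u v; apply: fP; rewrite -jimp !fK.
Qed.
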